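(* Let $p$ be an odd prime, $n\ge 2$ an integer, and $A$ an integer with $|A|<p/2$ and $p\nmid A$. Let $f(x)=Ax\bmod p$ (least positive residue) on $I=\{1,\dots,p-1\}$, and for $0\le j\le n-1$ let $I_j=\{x:1\le x\le p-1,\ x\equiv j\pmod n\}$. Call $f$ a Type (iv) map if there exist $i,j\in\{0,\dots,n-1\}$ with $f(I_i)\cap I_j=\emptyset$. If $p>n^3(n+3)$, then $f$ is a Type (iv) map if and only if $A$ can be written as $$A=\frac{tp-r}{s}\quad\text{with integers } t,r,s,\ \gcd(r,s)=1,\ s>0,\ 1\le |r|+s\le n.$$ *)

(* Defs.v *)
From mathcomp Require Export all_boot all_order all_algebra.
From mathcomp Require Export classical_sets.

Set Implicit Arguments.
Unset Strict Implicit.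
Unset Printing Implicit Defensive.

Import Order.TTheory GRing.Theory Num.Theory.
Local Open Scope ring_scope.
Local Open Scope classical_set_scope.

(* For p prime not dividing A and 1 <= x <= p - 1, the remainder is nonzero, so
   this is the least positive residue of A * x modulo p. *)
Definition mulmod (p : nat) (A : int) (x : int) : int :=
  ((A * x) %% p%:Z)%Z.

Definition residue_class (p n j : nat) : set int :=
  [set x : int | 1 <= x <= p%:Z - 1 /\ (x = j%:Z %[mod n%:Z])%Z].

Definition type_iv (p n : nat) (f : int -> int) : Prop :=
  exists i j : nat, [/\ (i < n)%N, (j < n)%N &
    (f @` residue_class p n i) `&` residue_class p n j = set0].

(* Main.v *)
(** The pairs (x, A x mod p) are the points of the lattice y = A x (mod p) in the
    open square (0, p)^2.  A primitive relation s A + r = 0 (mod p) puts them on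
    the lines r x + s y = m p, of which exactly |r| + s - 1 cross the square, and
    fixing x and y modulo n fixes m modulo n.  If |r| + s <= n, some class of m is
    missed, which yields an empty pair (i, j).  Conversely, Thue's lemma provides
    a relation with r^2, s^2 <= p; if |r| + s > n, every class of m contains a line
    whose chord is longer than the spacing n (s, -r) of the points with prescribed
    residues, so every pair (i, j) is attained. *)

Require Import Defs.
From mathcomp Require Import zify ring.
Import Order.TTheory GRing.Theory Num.Theory.
Local Open Scope ring_scope.

(** * Integer congruences and Bezout relations *)

Lemma eqz_mod_exists (n a b : int) :
  (a = b %[mod n])%Z <-> exists q, a = b + q * n.
Proof.
split.
- move/eqP; rewrite eqz_mod_dvd => /dvdzP [q hq]; exists q; lia.
- case=> q ->; apply/eqP; rewrite eqz_mod_dvd; apply/dvdzP; exists q; lia.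
Qed.

Lemma coprimez_bezout (a b : int) :
  gcdz a b = 1 -> exists u v : int, u * a + v * b = 1.
Proof. by move=> g; have [u [v h]] := Bezoutz a b; exists u, v; rewrite h g. Qed.

Lemma mod_class_window (n a c : int) : 0 < n ->
  exists q : int, a <= c + n * q < a + n.
Proof.
move=> n0; exists (- ((c - a) %/ n)%Z).
have n1 : n != 0 by lia.
have := divz_eq (c - a) n; have := modz_ge0 (c - a) n1; have := ltz_pmod (c - a) n0.
by move: (_ %/ _)%Z (_ %% _)%Z => q e *; nia.
Qed.

(** * Lattice points with prescribed residues on a line *)

(* The largest admissible [x] works: the line meets the open square in a segment
   longer than the step [n * s] between the lattice points of the class. *)
Lemma line_meets_class (p n r s i j m c : int) :
  0 < n -> 0 < r -> 0 < s -> gcdz r s = 1 ->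
  n * r < p -> n * s < p ->
  n * r * s < m * p -> n * r * s < (r + s - m) * p ->
  r * i + s * j + n * c = m * p ->
  exists x y : int, [/\ r * x + s * y = m * p, 0 < x < p, 0 < y < p,
    (x = i %[mod n])%Z & (y = j %[mod n])%Z].
Proof.
move=> n0 r0 s0 /coprimez_bezout [u [v uv]] hr hs hm hm' hc.
(* [T] is the largest [x] with [r * x < m * p], that is, with [y > 0] on the line. So [x <= B]
   encodes both [x < p] and [y > 0]. *)
have [T hT] := mod_class_window r (- r) (- (m * p)) r0.
pose B := Num.min (p - 1) T.
(* Bezout gives the point [(i + n * u * c, j + n * v * c)] of the line; [k] steps [(n * s, - n * r)]
   keep it on the line and in its classes. *)
have [k] : exists k : int,
    B - n * s + 1 <= i + n * u * c + n * s * k < B - n * s + 1 + n * s.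
  by apply: mod_class_window; nia.
set x := i + n * u * c + n * s * k => hx.
pose y := j + n * v * c - n * r * k.
have exy : r * x + s * y = m * p.
  by rewrite -hc /x /y -[n * c]mulr1 -uv; ring.
have [x0 xp lox] : [/\ 0 < x, x < p & (m - s) * p < r * x].
  have x_lt : x < p /\ r * x < m * p by rewrite /B in hx; nia.
  have x_max : p <= x + n * s \/ m * p <= r * x + r * (n * s).
    by rewrite /B in hx; case: (leP (p - 1) T) hx => ? ?; [left | right]; nia.
  (* One more step leaves the square. If through [x = p], then [hs] gives [x > 0] and [hm'] gives
     [y < p]; if through [y = 0], these come from [hm] and [hr]. *)
  by case: x_max => h; split; nia.
have hix : r * x < m * p by rewrite /B in hx; nia.
exists x, y; split=> //; first by lia.
- by apply/andP; split; nia.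
- by apply/eqz_mod_exists; exists (u * c + s * k); rewrite /x; ring.
- by apply/eqz_mod_exists; exists (v * c - r * k); rewrite /y; ring.
Qed.

Lemma congruence_meets_classes (p n r s i j B : int) :
  0 < n -> 0 < r -> 0 < s -> gcdz r s = 1 -> gcdz p n = 1 ->
  r * r <= p -> s * s <= p -> n < r + s -> n * n < p -> 4 * (n * n * n) <= p ->
  (p %| s * B + r)%Z -> gcdz s p = 1 ->
  exists x y : int, [/\ (y = B * x %[mod p])%Z, 0 < x < p, 0 < y < p,
    (x = i %[mod n])%Z & (y = j %[mod n])%Z].
Proof.
move=> n0 r0 s0 rs pn hr hs hN hn hn3 /dvdzP [t ht] sp.
have [a [b ab]] := coprimez_bezout p n pn.
have [c [d cd]] := coprimez_bezout s p sp.
have rsp : r * s <= p by nia.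
have nrsp : n * r * s <= n * p by rewrite -mulrA ler_pM2l.
(* Since [a] inverts [p] modulo [n], the prescribed residues of [x] and [y] amount to a single class
   for [m]. *)
have class m : (exists q, m = a * (r * i + s * j) + n * q) ->
  exists e, r * i + s * j + n * e = m * p.
  case=> q ->; exists (q * p - b * (r * i + s * j)).
  apply/eqP; rewrite -subr_eq0; set S := r * i + s * j.
  have -> : S + n * (q * p - b * S) - (a * S + n * q) * p =
      S * (1 - (a * p + b * n)) by ring.
  by rewrite ab subrr mulr0.
have [m hm [hm1 hm2]] : exists2 m, (exists q, m = a * (r * i + s * j) + n * q) &
    n * r * s < m * p /\ n * r * s < (r + s - m) * p.
  (* For [r + s >= 4 * n], taking [2 * n <= m < 3 * n] keeps [m] and [r + s - m] above [n], which
     suffices as [r * s <= p]. Otherwise [n * r * s < 4 * n ^ 3 <= p], and [1 <= m <= n < r + s] is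
     enough. *)
  case: (leP (4 * n) (r + s)) => hN4.
    have [q hq] := mod_class_window n (2 * n) (a * (r * i + s * j)) n0.
    exists (a * (r * i + s * j) + n * q); first by exists q.
    by move: (a * _ + _) hq => m hq; split; nia.
  have [q hq] := mod_class_window n 1 (a * (r * i + s * j)) n0.
  exists (a * (r * i + s * j) + n * q); first by exists q.
  have sq_lt : (r + s) * (r + s) < (4 * n) * (4 * n) by apply: ltr_pM => //; lia.
  have rs4 : r * s < 4 * (n * n) by have := sqr_ge0 (r - s); rewrite expr2; lia.
  have nrs_lt : n * r * s < p.
    by have : n * (r * s) < n * (4 * (n * n)); [rewrite ltr_pM2l | lia].
  have p_le k : 1 <= k -> p <= k * p by move=> k1; apply: ler_peMl; lia.
  by split; apply: lt_le_trans nrs_lt (p_le _ _); lia.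
have [e he] := class m hm.
have hnr : n * r < p by nia.
have hns : n * s < p by nia.
have [x [y [exy xp yp xi yj]]] :=
  line_meets_class _ _ _ _ _ _ _ _ n0 r0 s0 rs hnr hns hm1 hm2 he.
exists x, y; split=> //.
(* The line equation gives [s * (y - B * x) = (m - t * x) * p], and [c] inverts [s] modulo [p]. *)
apply/eqz_mod_exists; exists (c * m - c * t * x + d * (y - B * x)).
apply/eqP; rewrite -subr_eq0.
have -> : y - (B * x + (c * m - c * t * x + d * (y - B * x)) * p) =
  (y - B * x) * (1 - (c * s + d * p)) + c * (r * x + s * y - m * p)
    - c * (s * B + r - t * p) * x by ring.
by rewrite cd exy ht !subrr !(mulr0, mul0r) addr0 subr0.
Qed.

(** * Thue's lemma and its primitive form *)

Lemma nat_sqrt_exists (p : nat) : exists k : nat, (k * k <= p < k.+1 * k.+1)%N.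
Proof.
elim: p => [|p [k hk]]; first by exists 0%N.
by case: (leqP (k.+1 * k.+1) p.+1) => h; [exists k.+1 | exists k]; nia.
Qed.

(** Pigeonhole: with [k] the integer square root of [p], the more than [p] pairs in [[0, k]^2]
    cannot have distinct values of [z.1 * A + z.2] modulo [p]. The difference of two colliding pairs
    is the relation. *)
Lemma thue (p : nat) (A : int) : (0 < p)%N ->
  exists r s : int, [/\ (r, s) != (0, 0), r * r <= p, s * s <= p &
    (p %| s * A + r)%Z].
Proof.
move=> p0; have [k hk] := nat_sqrt_exists p.
have pn0 : p%:Z != 0 by lia.
have pp0 : 0 < p%:Z by lia.
pose g (z : 'I_k.+1 * 'I_k.+1) : int := ((z.1%:Z * A + z.2%:Z) %% p%:Z)%Z.
have glt z : (`|g z| < p)%N.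
  by have := modz_ge0 (z.1%:Z * A + z.2%:Z) pn0;
     have := ltz_pmod (z.1%:Z * A + z.2%:Z) pp0; rewrite -/(g z); lia.
pose f z : 'I_p := Ordinal (glt z).
have /injectivePn [z [z' zz' fzz]] : ~~ injectiveb f.
  apply/negP => /injectiveP /leq_card; rewrite card_prod !card_ord; lia.
have gzz : g z = g z'.
  have := congr1 val fzz; rewrite /f /=.
  have := modz_ge0 (z.1%:Z * A + z.2%:Z) pn0.
  have := modz_ge0 (z'.1%:Z * A + z'.2%:Z) pn0.
  by rewrite -/(g z) -/(g z'); lia.
have sq_le (a b : 'I_k.+1) : (a%:Z - b%:Z) * (a%:Z - b%:Z) <= p.
  have [ak bk] := (ltn_ord a, ltn_ord b).
  have : 0 <= (k%:Z - (a%:Z - b%:Z)) * (k%:Z + (a%:Z - b%:Z)) by apply: mulr_ge0; lia.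
  have : k%:Z * k%:Z <= p by lia.
  by lia.
exists (z.2%:Z - z'.2%:Z), (z.1%:Z - z'.1%:Z); split.
- apply: contra zz' => /eqP [e2 e1]; apply/eqP.
  by case: z z' e1 e2 {fzz gzz} => [a b] [a' b'] /= e1 e2;
     congr pair; apply: val_inj => /=; lia.
- exact: sq_le.
- exact: sq_le.
- move/eqP: gzz; rewrite /g eqz_mod_dvd.
  by congr (_ %| _)%Z; ring.
Qed.


(** Thue's relation is normalised to [s > 0] and divided by its gcd. Since [p] divides no nonzero
    integer of square at most [p], it divides neither the gcd nor [s]; then [r = 0] would force [p]
    to divide [A]. *)
Lemma thue_primitive (p : nat) (A : int) : prime p -> ~~ (p %| A)%Z ->
  exists r s : int, [/\ 0 < s, r != 0, gcdz r s = 1, r * r <= p /\ s * s <= p &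
    (p %| s * A + r)%Z /\ gcdz s p = 1].
Proof.
move=> pp pA; have p1 := prime_gt1 pp.
have dvdM (a b : int) : (p %| a * b)%Z -> (p %| a)%Z || (p %| b)%Z.
  by rewrite !dvdzE abszM /= Euclid_dvdM.
have small (a : int) : a * a <= p -> (p %| a)%Z -> a = 0.
  move=> ha /dvdzP [q hq]; have [q0|q0] := eqVneq q 0; first by rewrite hq q0 mul0r.
  have q1 : 1 <= q * q by nia.
  have pp1 : p%:Z < p%:Z * p%:Z by nia.
  have : p%:Z * p%:Z <= (q * q) * (p%:Z * p%:Z) by apply: ler_peMl; lia.
  by rewrite hq in ha; lia.
have [r [s [nz hr hs hd]]] := thue p A (prime_gt0 pp).
have s0 : s != 0.
  apply/eqP => s0; move: nz hd; rewrite s0 mul0r add0r => nz /(small _ hr) r0.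
  by rewrite r0 eqxx in nz.
wlog sgt : r s hr hs hd s0 nz / 0 < s.
  case: (ltrgtP 0 s) => [sgt|slt|/esym /eqP]; last by rewrite (negPf s0).
    by move=> /(_ r s); apply.
  move=> /(_ (- r) (- s)); apply; rewrite ?mulrNN ?oppr_eq0 ?oppr_gt0 //.
    by rewrite mulNr -opprD dvdzE abszN -dvdzE.
  by rewrite xpair_eqE !oppr_eq0.
have g0 : 0 < gcdz r s by rewrite /gcdz ltz_nat gcdn_gt0 !absz_gt0 s0 orbT.
set g := gcdz r s in g0.
have /dvdzP [r' er] : (g %| r)%Z by exact: dvdz_gcdl.
have /dvdzP [s' es] : (g %| s)%Z by exact: dvdz_gcdr.
have le_mulg (a b : int) : a = b * g -> b * b <= a * a.
  move=> ->; have gg : 1 <= g * g by nia.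
  rewrite [X in _ <= X](_ : _ = g * g * (b * b)); last by ring.
  by apply: ler_peMl; rewrite -?expr2 ?sqr_ge0 ?expr2.
have hr' : r' * r' <= p := le_trans (le_mulg _ _ er) hr.
have hs' : s' * s' <= p := le_trans (le_mulg _ _ es) hs.
have s'0 : 0 < s' by nia.
have hd' : (p %| s' * A + r')%Z.
  have : (p %| g * (s' * A + r'))%Z.
    by move: hd; rewrite er es; congr (_ %| _)%Z; ring.
  case/dvdM/orP => // /small g_0.
  have : g * g <= p by apply: le_trans hs; nia.
  by move/g_0; lia.
exists r', s'; split=> //.
- apply/eqP => r'0; move: hd'; rewrite r'0 addr0.
  by case/dvdM/orP => [/(small _ hs')|]; [lia | exact/negP].
- have := mulz_gcdl r' s' g.
  rewrite -er -es -/g => h; apply: (@mulIf _ g); first by rewrite gt_eqF.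
  by rewrite mul1r -[in RHS]h; congr (_ * _); lia.
- split=> //; rewrite gcdzC; apply/eqP; rewrite -[_ == _]/(coprimez p s').
  rewrite coprimezE /= prime_coprime //; apply/negP => h.
  have : (p %| s')%Z by rewrite dvdzE.
  by move/(small _ hs'); lia.
Qed.

(** * An empty pair of classes from a short relation *)

Lemma eq_div_intr (A a s : int) : s != 0 ->
  (A%:~R = a%:~R / s%:~R :> rat) <-> A * s = a.
Proof.
move=> s0; have s0' : s%:~R != 0 :> rat by rewrite intr_eq0.
split=> [h|<-]; last by rewrite intrM mulfK.
by apply/eqP; rewrite -(eqr_int rat) intrM h divfK.
Qed.

(* With [s * y + r * x = m * p], at most [|r| + s - 1 < n] consecutive values of
   [m] occur, so some residue class [m0] of [m] modulo [n] is missed. *)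
Lemma type_iv_of_short_relation (p n : nat) (A t r s : int) :
  (0 < n)%N -> gcdz p n = 1 -> (0 < p)%N -> r != 0 -> 0 < s -> gcdz r s = 1 ->
  `|r| + s <= n%:Z -> A * s = t * p%:Z - r ->
  type_iv p n (mulmod p A).
Proof.
move=> n0 pn p0 r0 s0 /coprimez_bezout [u [v uv]] rsn eA.
have [a [b ab]] := coprimez_bezout _ _ pn.
have nn0 : n%:Z != 0 by lia.
have np0 : 0 < n%:Z by lia.
(* In the square [0 < m < r + s] if [r > 0], and [r < m < s] if [r < 0]. As [m0] is an excluded
   endpoint and the length is at most [n], no such [m] is congruent to [m0] modulo [n]. *)
pose m0 : int := if 0 < r then 0 else s.
pose rep (w : int) : nat := `|(w %% n%:Z)%Z|%N.
have repE w : (rep w)%:Z = (w %% n%:Z)%Z by rewrite /rep gez0_abs ?modz_ge0.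
(* By [u * r + v * s = 1], these residues [i], [j] satisfy [r * i + s * j = m0 * p] modulo [n], so a
   common point would force [m] into the class of [m0]. *)
exists (rep (u * m0 * p%:Z)), (rep (v * m0 * p%:Z)); split.
- by have := ltz_pmod (u * m0 * p%:Z) np0; rewrite -repE.
- by have := ltz_pmod (v * m0 * p%:Z) np0; rewrite -repE.
apply/seteqP; split=> // y [[x [xp]]].
rewrite repE modz_mod => /eqz_mod_exists [q1 ex] yE [yp].
rewrite repE modz_mod => /eqz_mod_exists [q2 ey].
have [k ek] : exists k, A * x = k * p%:Z + y.
  by exists ((A * x) %/ p%:Z)%Z; rewrite {1}(divz_eq (A * x) p%:Z) -yE.
pose m := t * x - s * k.
have em : r * x + s * y = m * p%:Z.
  apply/eqP; rewrite -subr_eq0.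
  have -> : r * x + s * y - m * p%:Z =
      x * (A * s - (t * p%:Z - r)) - s * (A * x - (k * p%:Z + y)).
    by rewrite /m; ring.
  by rewrite eA ek !subrr !mulr0 subrr.
have em0 : (m - m0) * p%:Z = (r * q1 + s * q2) * n%:Z.
  apply/eqP; rewrite -subr_eq0.
  have -> : (m - m0) * p%:Z - (r * q1 + s * q2) * n%:Z =
     - (r * x + s * y - m * p%:Z) + r * (x - (u * m0 * p%:Z + q1 * n%:Z))
     + s * (y - (v * m0 * p%:Z + q2 * n%:Z)) + m0 * p%:Z * (u * r + v * s - 1) by ring.
  by rewrite em -ex -ey uv !subrr !mulr0 oppr0 !addr0.
(* The factor [p] cancels modulo [n] by coprimality. *)
have [z ez] : exists z, m - m0 = z * n%:Z.
  exists (a * (r * q1 + s * q2) + b * (m - m0)).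
  transitivity ((m - m0) * (a * p%:Z + b * n%:Z)); first by rewrite ab mulr1.
  transitivity (a * ((m - m0) * p%:Z) + b * (m - m0) * n%:Z); first by ring.
  by rewrite em0; ring.
have [hlo hhi] : - n%:Z < m - m0 < n%:Z /\ m - m0 != 0.
  have sy0 : 0 < s * y by apply: mulr_gt0; lia.
  have syp : s * y < s * p%:Z by rewrite ltr_pM2l //; lia.
  rewrite /m0; case: (ltrP 0 r) => hr.
    have rx0 : 0 < r * x by apply: mulr_gt0; lia.
    have rxp : r * x < r * p%:Z by rewrite ltr_pM2l //; lia.
    have m_gt0 : 0 < m by rewrite -(@ltr_pM2r _ p%:Z) ?mul0r -?em; lia.
    have m_lt : m < r + s by rewrite -(@ltr_pM2r _ p%:Z) -?em; lia.
    by lia.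
  have rx0 : r * x < 0 by rewrite nmulr_rlt0; lia.
  have rxp : r * p%:Z < r * x by rewrite ltr_nM2l; lia.
  have m_gt : r < m by rewrite -(@ltr_pM2r _ p%:Z) -?em; lia.
  have m_lt : m < s by rewrite -(@ltr_pM2r _ p%:Z) -?em; lia.
  by lia.
have [z0|z0] := eqVneq z 0; first by rewrite z0 mul0r in ez; rewrite ez eqxx in hhi.
have : n%:Z <= `|z| * n%:Z by apply: ler_peMl; lia.
by have := normrM z n%:Z; lia.
Qed.

(** * The equivalence for large primes *)

Theorem theorem1p5 (p n : nat) (A : int)
    (p_prime : prime p) (p_odd : odd p) (n_ge2 : (2 <= n)%N)
    (A_small : `|A|%:~R < p%:R / 2 :> rat) (p_ndvd_A : ~~ (p%:Z %| A)%Z)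
    (p_large : (n ^ 3 * (n + 3) < p)%N) :
  type_iv p n (mulmod p A) <->
  exists t r s : int,
    [/\ A%:~R = (t * p%:Z - r)%:~R / s%:~R :> rat,
        gcdz r s = 1,
        0 < s &
        1 <= `|r| + s <= n%:Z].
Proof.
have p0 := prime_gt0 p_prime.
have cube : (n ^ 3 = n * n * n)%N by rewrite !expnS expn0 muln1 mulnA.
have n4 : (4 * (n * n * n) < p)%N.
  by apply: leq_ltn_trans p_large; rewrite cube mulnC leq_mul2l; apply/orP; right; lia.
have n3 : (n * n < p)%N.
  apply: leq_trans n4; rewrite ltnS.
  have : (n * n * 1 <= n * n * n)%N by rewrite leq_mul2l; apply/orP; right; lia.
  by move: (n * n * n)%N; lia.
clear p_large cube.
have pn : gcdz p n = 1.
  have : coprime p n by rewrite prime_coprime // gtnNdvd //; nia.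
  by rewrite /coprime /gcdz /= => /eqP ->.
split=> [[i [j [_ _ disj]]] | [t [r [s [eA rs s0 hN]]]]]; last first.
  have {}eA : A * s = t * p%:Z - r by apply/eq_div_intr; rewrite ?gt_eqF.
  apply: (@type_iv_of_short_relation p n A t r s) => //; [lia | | lia].
  (* If [r = 0], coprimality forces [s = 1], so [A = t * p], against [p_ndvd_A]. *)
  apply/eqP => r0; move: rs eA p_ndvd_A; rewrite r0 gcd0z => s1.
  have -> : s = 1 by lia.
  by rewrite mulr1 subr0 => -> /negP; apply; apply: dvdz_mull.
have [r [s [s0 r0 rs [hr hs] [hd sp]]]] := thue_primitive p A p_prime p_ndvd_A.
(* If Thue's relation is short, it is the required representation of [A]; if not, the pair [(i, j)]
   is attained, contradicting [disj]. *)
have [hN|hN] := leP (`|r| + s) n%:Z.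
  have /dvdzP [t ht] := hd.
  exists t, r, s; split=> //; last by lia.
  by apply/eq_div_intr; rewrite ?gt_eqF // -ht; ring.
suff [x [y [exy xp yp xi yj]]] : exists x y : int,
    [/\ (y = A * x %[mod p])%Z, 0 < x < p, 0 < y < p,
    (x = i %[mod n])%Z & (y = j %[mod n])%Z].
  have : set0 y; last by [].
  rewrite -disj; split; last by split=> //; lia.
  exists x; first by split=> //; lia.
  by rewrite /mulmod -exy modz_small //; lia.
have [nZ n2Z n3Z] : [/\ 0 < n%:Z, n%:Z * n%:Z < p%:Z &
    4 * (n%:Z * n%:Z * n%:Z) <= p%:Z] by split; lia.
case: (ltrP 0 r) => rsgn.
  by apply: (@congruence_meets_classes p n r s i j A) => //; lia.
(* For [r < 0] reflect [x] to [p - x], which turns [A] into [- A]. *)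
have reflected : exists x y : int,
    [/\ (y = - A * x %[mod p])%Z, 0 < x < p, 0 < y < p,
    (x = p%:Z - i%:Z %[mod n])%Z & (y = j %[mod n])%Z].
  apply: (@congruence_meets_classes p n (- r) s) => //.
  - by lia.
  - by rewrite /gcdz abszN.
  - by rewrite mulrNN.
  - by lia.
  - by rewrite mulrN -opprD dvdzE abszN -dvdzE.
have [x [y [exy xp yp /eqz_mod_exists [q xi] yj]]] := reflected.
exists (p%:Z - x), y; split=> //.
- rewrite exy; apply/eqz_mod_exists; exists (- A); ring.
- by lia.
- by apply/eqz_mod_exists; exists (- q); rewrite xi; ring.
Qed.
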